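(* The competitive ratio for Non-monotone Prophet with non-negative values is $\Theta(n)$. That is, there is an online algorithm whose competitive ratio is $O(n)$ on every instance, and there exist instances on which every online algorithm has competitive ratio $\Omega(n)$.
   Context: Non-monotone Prophet: there are $n$ items with independently distributed non-negative values $X_i\sim\mathcal{D}_i$, and an arbitrary (not necessarily downward-closed) family $\mathcal{F}$ of subsets of $[n]$ of feasible sets. The algorithm knows $n$, $\mathcal{F}$ and the distributions, observes $X_1,\dots,X_n$ one at a time in this order, and after observing $X_i$ decides immediately and irrevocably whether to select item $i$; the final set $W$ of selected items must belong to $\mathcal{F}$. Its value is $\sum_{i\in W}X_i$. The competitive ratio is the worst case over instances of $\mathbb{E}[\max_{S\in\mathcal{F}}\sum_{i\in S}X_i]/\mathbb{E}[\sum_{i\in W}X_i]$. *)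

(* Defs.v *)
From HB Require Import structures.
From mathcomp Require Import all_boot all_order all_algebra.
From mathcomp Require Import all_classical all_reals all_analysis.

Set Implicit Arguments.
Unset Strict Implicit.
Unset Printing Implicit Defensive.

Import Order.TTheory GRing.Theory Num.Theory.

Local Open Scope classical_set_scope.
Local Open Scope ring_scope.

(* The index set is finite and [setT] is an allowed choice of [B i], so this
   contains the product rule for every subfamily. *)
Definition mutually_independent (R : realType) (d : measure_display)
    (T : measurableType d) (P : probability T R) (n : nat)
    (X : 'I_n -> {RV P >-> R}) : Prop :=
  forall B : 'I_n -> set R, (forall i, measurable (B i)) ->
    P (\bigcap_(i in [set: 'I_n]) (X i @^-1` B i)) =
    (\prod_(i < n) P (X i @^-1` B i))%E.

Record instance (R : realType) (n : nat) := Instance {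
  inst_display : measure_display ;
  inst_space : measurableType inst_display ;
  inst_prob : probability inst_space R ;
  item : 'I_n -> {RV inst_prob >-> R} ;
  item_ge0 : forall i w, 0 <= item i w ;
  item_indep : mutually_independent item ;
  feas : {set {set 'I_n}} ;
  feas_neq0 : feas != finset.set0
}.

(* What an algorithm is told about the items: their distributions, but neither the
   sample space nor the random variables. *)
Definition item_law (R : realType) (n : nat) (I : instance R n) (i : 'I_n) :
    probability R R :=
  distribution (inst_prob I) (item I i).

Definition prefix_upto (R : realType) (n : nat) (x : 'I_n -> R) (i : 'I_n) :
    i.+1.-tuple R :=
  [tuple x (widen_ord (ltn_ord i) j) | j < i.+1].

(* [alg_select i (s, y)] decides whether item [i] is selected, where [y] lists
   the values observed so far, that of item [i] included, and [s] is the internal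
   randomness, drawn once and for all from [alg_seed_prob] independently of the
   items. Past decisions are functions of [s] and [y], hence not arguments. *)
Record online_algorithm (R : realType) (n : nat) := OnlineAlgorithm {
  alg_display : measure_display ;
  alg_seed : measurableType alg_display ;
  alg_seed_prob : probability alg_seed R ;
  alg_select : forall i : 'I_n,
    (alg_seed * i.+1.-tuple R)%type -> bool ;
  alg_select_measurable : forall i : 'I_n,
    measurable_fun [set: (alg_seed * i.+1.-tuple R)%type]
      (@alg_select i)
}.

Definition deterministic (R : realType) (n : nat) (A : online_algorithm R n) :
    Prop :=
  forall (i : 'I_n) (s s' : alg_seed A) (y : i.+1.-tuple R),
    alg_select (s, y) = alg_select (s', y).

Definition selected (R : realType) (n : nat) (A : online_algorithm R n)
    (s : alg_seed A) (x : 'I_n -> R) : {set 'I_n} :=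
  [set i : 'I_n | alg_select (s, prefix_upto x i)]%SET.

Definition feasible (R : realType) (n : nat) (F : {set {set 'I_n}})
    (A : online_algorithm R n) : Prop :=
  forall (s : alg_seed A) (x : 'I_n -> R), (forall i, 0 <= x i) ->
    selected s x \in F.

Definition alg_value (R : realType) (n : nat) (I : instance R n)
    (A : online_algorithm R n) : \bar R :=
  'E_((inst_prob I \x alg_seed_prob A)%E)[fun z =>
     \sum_(i in selected z.2 (fun j => item I j z.1)) item I i z.1].

(* The default value [0] of the maximum is harmless: [feas I] is nonempty and the
   items are nonnegative. *)
Definition prophet_value (R : realType) (n : nat) (I : instance R n) : \bar R :=
  'E_(inst_prob I)[fun w =>
     \big[Num.max/0]_(S in feas I) \sum_(i in S) item I i w].

(* Division in [\bar R]: [x / 0 = +oo] for [0 < x], while the indeterminate forms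
   [0 / 0] and [+oo / +oo] have value [0]. *)
Definition competitive_ratio (R : realType) (n : nat) (I : instance R n)
    (A : online_algorithm R n) : \bar R :=
  (prophet_value I / alg_value I A)%E.

(* Main.v *)
(** Upper bound: select, before seeing any value, a feasible set of largest
    expected total value [M]. Every item belonging to some feasible set has
    mean at most [M], and the prophet collects at most the sum of all those
    items, so it gets at most [n M].

    Lower bound: with [m = n./2], the first [m] items are worthless "keys" and
    the other [k = n - m] items ("prizes") are independent Bernoulli variables
    of parameter [1 / k]. A feasible set consists of the prize [i] together
    with the key [i - m], or without key if [i - m = m], which occurs only for
    odd [n]. The keys reveal nothing, yet choosing among them already
    determines the prize, so that every algorithm earns at most [1 / k]. The
    prophet earns [1] unless all prizes vanish, that is with probability
    [1 - (1 - 1 / k) ^ k >= 1 / 2]. *)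
Require Import Defs.
From HB Require Import structures.
From mathcomp Require Import all_boot all_order all_algebra.
From mathcomp Require Import all_classical all_reals all_analysis.
From mathcomp Require Import measurable_realfun lra zify.

Set Implicit Arguments.
Unset Strict Implicit.
Unset Printing Implicit Defensive.

Import Order.TTheory GRing.Theory Num.Theory.

Local Open Scope classical_set_scope.
Local Open Scope ring_scope.

(** * Quotients in [\bar R] and Bernoulli's inequality *)

Lemma lee_divl_of_le_mul (R : realType) (x y : \bar R) (r : R) :
  (0 <= r)%R -> (0 <= x)%E -> (0 <= y)%E -> (x <= r%:E * y)%E ->
  (x / y <= r%:E)%E.
Proof.
move=> r0 x0; case: y => [y| |]//; last first.
  by move=> _ _; rewrite invey mule0 lee_fin.
(* The case [y = 0] forces [x = 0], and [0 / 0] has value [0]. *)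
rewrite lee_fin le_eqVlt => /predU1P[<-|y0].
  rewrite mule0 => x0'; have -> : x = 0%E by apply/eqP; rewrite eq_le x0' x0.
  by rewrite mul0e lee_fin.
rewrite inver gt_eqF// => xry.
by rewrite lee_pdivrMr.
Qed.

Lemma lee_divr_of_mul_le (R : realType) (x y : \bar R) (r : R) :
  (0 < x)%E -> (0 <= y < +oo)%E -> (r%:E * y <= x)%E ->
  (r%:E <= x / y)%E.
Proof.
move=> x0; case: y => [y| |]//; rewrite ?ltxx ?andbF// lee_fin => /andP[+ _].
(* For [y = 0] the quotient is [+oo], since [x] is positive. *)
rewrite le_eqVlt => /predU1P[<- _|y0]; first by rewrite inve0 gt0_muley// leey.
by rewrite inver gt_eqF// => ?; rewrite lee_pdivlMr.
Qed.

(** Bernoulli's inequality, used below with [x = 1 / k] and exponent [k] to get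
    [(1 + 1 / k) ^ k >= 2]. *)
Lemma le_1Dn_expr (R : realDomainType) (n : nat) (x : R) :
  0 <= x -> 1 + x *+ n <= (1 + x) ^+ n.
Proof.
move=> x0; elim: n => [|n IH]; first by rewrite mulr0n addr0 expr0.
rewrite exprS mulrS; have := mulrn_wge0 n x0; nra.
Qed.

(** * Algorithms that fix their set in advance *)

Definition static_algorithm (R : realType) (n : nat) (S : {set 'I_n}) :
    online_algorithm R n :=
  @OnlineAlgorithm R n _ unit (dirac tt) (fun i _ => i \in S)
    (fun i => measurable_cst _).

Lemma selected_static (R : realType) n (S : {set 'I_n})
    (s : alg_seed (static_algorithm R S)) (x : 'I_n -> R) :
  selected s x = S.
Proof. by apply/setP => i; rewrite inE. Qed.

(* The absolute value, harmless for nonnegative items, keeps the integrand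
   nonnegative for an arbitrary law. *)
Definition mean_sum (R : realType) n (law : 'I_n -> probability R R)
    (S : {set 'I_n}) : \bar R :=
  (\sum_(i in S) \int[law i]_x `|x|%:E)%E.

(** The order on [\bar R] is total, so a maximum exists even with infinite means; [S0] supplies the
    member of [F] that [arg max] starts from. *)
Definition best_set (R : realType) n (F : {set {set 'I_n}})
    (law : 'I_n -> probability R R) : {set 'I_n} :=
  let S0 := odflt finset.set0 [pick S in F] in
  [arg max_(S > S0 in F) mean_sum law S]%O.

Lemma best_setP (R : realType) n (F : {set {set 'I_n}})
    (law : 'I_n -> probability R R) : F != finset.set0 ->
  best_set F law \in F /\
  forall S, S \in F -> (mean_sum law S <= mean_sum law (best_set F law))%E.
Proof.
move=> /finset.set0Pn [S1 S1F]; rewrite /best_set /=.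
have S0F : odflt finset.set0 [pick S in F] \in F.
  by case: pickP => //= /(_ S1); rewrite S1F.
by case: arg_maxP.
Qed.

(** * Upper bound: prophet against the best fixed set *)

Section upper_bound.
Local Open Scope ereal_scope.
Context (R : realType) (n : nat) (I : instance R n).

(** Change of variables, after which nonnegativity removes the absolute value: what the laws alone
    give is the true mean. *)
Lemma item_lawE i :
  \int[item_law I i]_x `|x|%:E = \int[inst_prob I]_w (item I i w)%:E.
Proof.
rewrite /item_law ge0_integral_distribution//.
  by apply: eq_integral => w _ /=; rewrite ger0_norm// item_ge0.
by apply/measurable_EFinP; exact: normr_measurable.
Qed.

Lemma integral_sum_items (S : {set 'I_n}) :
  \int[inst_prob I]_w (\sum_(i in S) item I i w)%:E = mean_sum (item_law I) S.
Proof.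
rewrite /mean_sum (eq_bigr _ (fun i _ => item_lawE i)) -big_enum/=.
rewrite -ge0_integral_sum//.
- by apply: eq_integral => w _; rewrite big_enum /= sumEFin.
- by move=> i; apply/measurable_EFinP.
- by move=> i w _; rewrite lee_fin item_ge0.
Qed.

Lemma measurable_sum_items (S : {set 'I_n}) :
  measurable_fun [set: inst_space I] (fun w => (\sum_(i in S) item I i w)%R).
Proof.
apply: (eq_measurable_fun (fun w => \sum_(i <- enum S) item I i w)%R).
  by move=> w _; rewrite big_enum.
exact: measurable_sum.
Qed.

Lemma alg_value_static (S : {set 'I_n}) :
  alg_value I (static_algorithm R S) = mean_sum (item_law I) S.
Proof.
rewrite /alg_value unlock /=.
under eq_integral do rewrite selected_static.
(* The seed lives on a one-point space of mass [1], so the inner integral is that of a constant. *)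
rewrite (fubini_tonelli1
  (fun z : inst_space I * unit => (\sum_(i in S) item I i z.1)%:E)).
- rewrite /fubini_F -integral_sum_items; apply: eq_integral => w _ /=.
  by rewrite integral_cst//= probability_setT mule1.
- apply/measurable_EFinP/(measurableT_comp (measurable_sum_items S)).
  exact: measurable_fst.
- by move=> z; rewrite lee_fin sumr_ge0// => i _; exact: item_ge0.
Qed.

Lemma mean_sum_ge0 (S : {set 'I_n}) : 0 <= mean_sum (item_law I) S.
Proof. by apply: sume_ge0 => i _; apply: integral_ge0. Qed.

Lemma measurable_prophet : measurable_fun [set: inst_space I]
  (fun w => (\big[Num.max/0]_(S in feas I) \sum_(i in S) item I i w)%R).
Proof.
apply: (eq_measurable_fun
  (fun w => (\big[Num.max/0]_(S <- enum (feas I)) \sum_(i in S) item I i w)%R)).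
  by move=> w _; rewrite big_enum.
elim: (enum _) => [|S s IH].
  by under eq_fun do rewrite big_nil; exact: measurable_cst.
under eq_fun do rewrite big_cons.
by apply: measurable_maxr => //; exact: measurable_sum_items.
Qed.

(** Pointwise, each feasible sum is part of the sum over the union of all feasible sets. *)
Lemma prophet_le_cover :
  prophet_value I <= mean_sum (item_law I) (finset.cover (feas I)).
Proof.
rewrite /prophet_value unlock -integral_sum_items ge0_le_integral//.
- move=> w _; rewrite lee_fin; elim/big_ind: _ => // [x y x0 y0|S _].
    by rewrite le_max x0.
  by apply: sumr_ge0 => i _; exact: item_ge0.
- by apply/measurable_EFinP; exact: measurable_prophet.
- by apply/measurable_EFinP; exact: measurable_sum_items.
move=> w _; rewrite lee_fin; apply: bigmax_le.
  by apply: sumr_ge0 => i _; exact: item_ge0.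
move=> S SF; rewrite [leRHS](big_setID S) /= (finset.setIidPr _); last first.
  exact: finset.bigcup_sup.
by rewrite lerDl; apply: sumr_ge0 => i _; exact: item_ge0.
Qed.

(** Compared term by term with [n] copies of [M]: an item of the union lies in some feasible [S],
    whose mean is at most [M]; any other item contributes [0]. *)
Lemma mean_sum_cover :
  mean_sum (item_law I) (finset.cover (feas I)) <=
  n%:R%:E * mean_sum (item_law I) (best_set (feas I) (item_law I)).
Proof.
set M := mean_sum _ (best_set _ _).
have [_ bestP] := best_setP (item_law I) (feas_neq0 I).
have M0 : 0 <= M by exact: mean_sum_ge0.
have -> : n%:R%:E * M = \sum_(i < n) M.
  by rewrite mule_natl sumr_const card_ord.
rewrite /mean_sum [leLHS]big_mkcond/=; apply: lee_sum => i _.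
case: ifPn => // /finset.bigcupP[S SF iS]; apply: le_trans (bestP _ SF).
rewrite /mean_sum (bigD1 i)//= leeDl// sume_ge0// => j _.
by apply: integral_ge0 => x _; rewrite lee_fin.
Qed.

End upper_bound.

(** * Product Bernoulli measure on bit vectors *)

Definition coins (n : nat) := {ffun 'I_n -> bool}.
HB.instance Definition _ n := Finite.on (coins n).
HB.instance Definition _ n := isPointed.Build (coins n) [ffun=> false].
HB.instance Definition _ n := @isMeasurable.Build default_measure_display
  (coins n) discrete_measurable discrete_measurable0
  discrete_measurableC discrete_measurableU.

Section independent_coins.
Context (R : realType) (n : nat) (p : R) (p01 : 0 <= p <= 1).

Definition coin_weight (b : bool) : R := if b then p else 1 - p.

Lemma coin_weight_ge0 b : 0 <= coin_weight b.
Proof.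
by case: b; rewrite /coin_weight; case/andP: p01 => // _; rewrite subr_ge0.
Qed.

Lemma coins_weight_ge0 (t : coins n) : 0 <= \prod_(i < n) coin_weight (t i).
Proof. by apply: prodr_ge0 => i _; exact: coin_weight_ge0. Qed.

(** A finite combination of Dirac masses inherits the measure structure; vectors are enumerated
    because [msum] is indexed by natural numbers. *)
Definition coin_prob : set (coins n) -> \bar R :=
  msum (fun k => let t := nth point (enum {: coins n}) k in
    mscale (NngNum (coins_weight_ge0 t)) (dirac t)) #|{: coins n}|.

HB.instance Definition _ := Measure.on coin_prob.

Lemma coin_probE (A : set (coins n)) :
  coin_prob A = (\sum_(t : coins n)
    (\prod_(i < n) coin_weight (t i) * \1_A t))%:E.
Proof.
rewrite /coin_prob /msum -sumEFin.
rewrite [RHS](eq_bigl (mem {: coins n}))// [RHS]big_enum_val.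
apply: eq_bigr => k _; rewrite (enum_val_nth (point : coins n)).
by rewrite /mscale EFinM.
Qed.

(** The indicator of a box factors over the coordinates, so the sum over vectors is an expanded
    product of sums. Total mass, marginals and independence derive from this formula. *)
Lemma coin_prob_box (B : 'I_n -> set bool) :
  coin_prob [set t | forall i, B i (t i)] =
  (\prod_(i < n) (\sum_(b : bool) coin_weight b * \1_(B i) b))%:E.
Proof.
rewrite coin_probE; congr EFin; rewrite bigA_distr_bigA; apply: eq_bigr => t _.
rewrite [RHS]big_split /=; congr *%R; rewrite indicE.
have [H|/asboolPn/existsp_asboolPn [i Bi]] := pselect (forall i, B i (t i)).
  rewrite mem_set// big1// => i _; rewrite indicE mem_set//; exact: H.
rewrite memNset; last by move=> /(_ i).
by rewrite (bigD1 i)//= indicE memNset// mul0r.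
Qed.

Lemma coin_prob_setT : coin_prob [set: coins n] = 1%E.
Proof.
rewrite (_ : [set: coins n] = [set t | forall i, setT (t i)]); last first.
  by apply/seteqP; split.
rewrite (coin_prob_box (fun=> setT)) big1// => i _.
by rewrite big_bool /coin_weight /= !indicT !mulr1 addrC subrK.
Qed.

HB.instance Definition _ :=
  Measure_isProbability.Build _ _ _ coin_prob coin_prob_setT.

Lemma coin_prob_marginal (i : 'I_n) (B : set bool) :
  coin_prob [set t | B (t i)] = (\sum_(b : bool) coin_weight b * \1_B b)%:E.
Proof.
rewrite (_ : [set t | B (t i)] =
    [set t | forall j, (if j == i then B else setT) (t j)]); last first.
  apply/seteqP; split=> t /= Bt; last by have := Bt i; rewrite eqxx.
  by move=> j; case: eqP => [->|].
rewrite (coin_prob_box (fun j => if j == i then B else setT)) (bigD1 i)//=.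
rewrite eqxx [X in _ * X]big1 ?mulr1// => j ji.
by rewrite (negbTE ji) big_bool /coin_weight /= !indicT !mulr1 addrC subrK.
Qed.

Lemma coin_prob_indep (B : 'I_n -> set bool) :
  coin_prob [set t | forall i, B i (t i)] =
  (\prod_(i < n) coin_prob [set t | B i (t i)])%E.
Proof.
rewrite coin_prob_box -prodEFin; apply: eq_bigr => i _.
by rewrite coin_prob_marginal.
Qed.

Lemma coin_prob_true (i : 'I_n) : coin_prob [set t : coins n | t i] = p%:E.
Proof.
rewrite (coin_prob_marginal i [set b | b]) big_bool /coin_weight /= !indicE.
by rewrite mem_set// memNset//= mulr1 mulr0 addr0.
Qed.

Lemma coin_prob_all_false (A : {pred 'I_n}) :
  coin_prob [set t : coins n | forall i, A i -> ~~ t i] = ((1 - p) ^+ #|A|)%:E.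
Proof.
rewrite (coin_prob_box (fun i => [set b | A i -> ~~ b])); congr EFin.
rewrite (bigID A)/= [X in _ * X]big1 ?mulr1 => [|i Ai]; last first.
  rewrite big_bool /= !indicE !mem_set//=; last by rewrite (negbTE Ai).
  by rewrite !mulr1 /coin_weight addrC subrK.
rewrite -prodr_const; apply: eq_bigr => i Ai.
rewrite big_bool /= !indicE memNset ?mem_set//=; last by move=> /(_ Ai).
by rewrite mulr0 add0r mulr1.
Qed.

End independent_coins.

(** * Lower bound: the instance with keys and prizes *)

Section lower_bound.
Context (R : realType) (n : nat) (n_gt0 : (0 < n)%N).

Let m := n./2.

Let p : R := (n - m)%:R^-1.

Lemma half_lt : (m < n)%N.
Proof. by rewrite /m; lia. Qed.

Lemma bias01 : 0 <= p <= 1.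
Proof.
have nm : (0 < n - m)%N by rewrite subn_gt0 half_lt.
by rewrite invr_ge0 ler0n /= invf_le1 ?ler1n ?ltr0n.
Qed.

Let P : probability (coins n) R := coin_prob bias01.

(** Keys have coins too, but the guard makes them worth zero; item [i] depends on coin [i] alone,
    whence independence. *)
Definition prize (i : 'I_n) : set (coins n) := [set t | (m <= i)%N && t i].

Lemma measurable_prize i : measurable (prize i).
Proof. by []. Qed.

Definition prize_item (i : 'I_n) : {RV P >-> R} :=
  mindic R (measurable_prize i).

Lemma prize_itemE i t : prize_item i t = ((m <= i)%N && t i)%:R.
Proof.
by rewrite /= mindicE; congr (nat_of_bool _)%:R; apply/idP/idP; rewrite inE.
Qed.

Lemma prize_item_ge0 i t : 0 <= prize_item i t.
Proof. by rewrite prize_itemE ler0n. Qed.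

Lemma prize_item_indep : mutually_independent prize_item.
Proof.
move=> B _.
pose C i := [set b : bool | B i ((m <= i)%N && b)%:R].
have CE i (t : coins n) : C i (t i) = B i (prize_item i t).
  by rewrite prize_itemE.
transitivity (coin_prob bias01 [set t : coins n | forall i, C i (t i)]).
  congr (coin_prob _ _); apply/seteqP; split=> t /= Bt i.
    by rewrite CE; exact: Bt.
  by move=> _; rewrite /preimage /= -CE.
rewrite coin_prob_indep; apply: eq_bigr => i _; congr (coin_prob _ _).
by apply/seteqP; split=> t /=; rewrite CE.
Qed.

(** The guard [j < m] matters for [i = m + m]: it keeps the prize [m] from serving as a key. *)
Definition key_set (i : 'I_n) : {set 'I_n} :=
  [set j : 'I_n | (j == i) || ((j < m) && (j + m == i))%N]%SET.

Definition key_family : {set {set 'I_n}} :=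
  [set key_set i | i in [pred i : 'I_n | (m <= i)%N]]%SET.

Lemma key_family_neq0 : key_family != finset.set0.
Proof.
apply/finset.set0Pn; exists (key_set (Ordinal half_lt)).
by apply: imset_f; rewrite inE /=.
Qed.

Lemma key_set_inj (i i' : 'I_n) : (m <= i)%N -> (m <= i')%N ->
  (forall j : 'I_n, (j < m)%N -> (j \in key_set i) = (j \in key_set i')) ->
  i = i'.
Proof.
move=> mi mi' eqS.
have key (j : 'I_n) (k : 'I_n) : (m <= k)%N -> (j < m)%N ->
    (j \in key_set k) = (j + m == k)%N.
  move=> mk jm; rewrite inE jm /=; case: eqP => // jk.
  by move: mk; rewrite -jk leqNgt jm.
have lekey (a b : 'I_n) : (m <= a)%N -> (m <= b)%N ->
  (forall j : 'I_n, (j < m)%N -> (j \in key_set a) = (j \in key_set b)) ->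
  (a < m + m)%N -> a = b.
  move=> ma mb eqab am.
  have jn : (a - m < n)%N by have := ltn_ord a; lia.
  have jm : (a - m < m)%N by lia.
  have := eqab (Ordinal jn) jm; rewrite !key//= subnK// eqxx => /esym/eqP ab.
  exact: val_inj.
have [im|im] := ltnP i (m + m); first exact: lekey.
have [im'|im'] := ltnP i' (m + m).
  by apply/esym; apply: lekey => // j jm; rewrite eqS.
(* Neither prize has a key; since [n <= m + m + 1], both indices equal [m + m]. *)
apply: val_inj => /=; have := ltn_ord i; have := ltn_ord i'.
move: im im'; rewrite /m; lia.
Qed.

Definition key_instance : instance R n :=
  Instance prize_item_ge0 prize_item_indep key_family_neq0.

Lemma sum_key_set (i : 'I_n) (t : coins n) : (m <= i)%N ->
  \sum_(j in key_set i) prize_item j t = (t i)%:R.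
Proof.
move=> mi; rewrite (bigD1 i)/=; last by rewrite inE eqxx.
rewrite big1 ?addr0 => [|j /andP[]]; first by rewrite prize_itemE mi.
rewrite inE => /orP[->//|/andP[jm _] _].
by rewrite prize_itemE leqNgt jm.
Qed.

Lemma prophet_key_ge : ((1 / 2)%:E <= prophet_value key_instance)%E.
Proof.
pose Z : set (coins n) := [set t | forall i : 'I_n, (m <= i)%N -> ~~ t i].
have PZ : (P Z <= (1 / 2)%:E)%E.
  rewrite /P /= (coin_prob_all_false _ [pred i : 'I_n | (m <= i)%N]) lee_fin.
  have -> : #|[pred i : 'I_n | (m <= i)%N]| = (n - m)%N.
    rewrite -sum1_card (eq_bigl (fun i : 'I_n => (m <= i)%N))//.
    rewrite -(big_mkord (leq m) (fun=> 1%N)).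
    rewrite -(big_nat_widenl m 0 n xpredT)//.
    by rewrite sum_nat_const_nat muln1.
  have k0 : 0 < (n - m)%:R :> R by rewrite ltr0n subn_gt0 half_lt.
  have /andP[p0 p1] := bias01.
  have kp : (n - m)%:R * p = 1 by rewrite divff// gt_eqF.
  (* With [k = n - m], dividing [(1 - p ^ 2) ^ k <= 1] by [(1 + p) ^ k >= 2] yields
     [(1 - p) ^ k <= 1 / 2]. *)
  have le2 : 2 <= (1 + p) ^+ (n - m).
    by apply: le_trans (le_1Dn_expr _ p0); rewrite -(mulr_natl p) kp; lra.
  have le1 : (1 - p) ^+ (n - m) * (1 + p) ^+ (n - m) <= 1.
    rewrite -exprMn; apply: exprn_ile1; first by nra.
    by nra.
  have ge0 : 0 <= (1 - p) ^+ (n - m) by rewrite exprn_ge0// subr_ge0.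
  nra.
have -> : (1 / 2 = 1 - 1 / 2 :> R) by lra.
rewrite EFinB; apply: (@le_trans _ _ (P (~` Z))).
  by rewrite probability_setC// leeB.
have -> : P (~` Z) = (\int[P]_t (\1_(~` Z) t)%:E)%E.
  by rewrite integral_indic// setIT.
rewrite /prophet_value unlock /=; apply: ge0_le_integral => //.
move=> t _; rewrite lee_fin indicE.
have [/set_mem/= /existsNP[i /not_implyP[mi /negP]]|_] := boolP (t \in ~` Z).
  rewrite negbK => ti.
  have SF : key_set i \in key_family by exact: imset_f.
  apply: le_trans (le_bigmax_cond _ _ SF).
  by rewrite sum_key_set// ti.
exact: bigmax_ge_id.
Qed.

(** * An arbitrary online algorithm on this instance *)

Section algorithm.
Variables (A : online_algorithm R n) (A_feas : feasible key_family A).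

(** The all-zero input shows the algorithm the same keys as any outcome, so it reveals the prize
    that the seed alone determines. *)
Definition commits_to (i : 'I_n) : set (alg_seed A) :=
  [set s | selected s (fun=> 0) = key_set i].

Lemma measurable_commits_to i : measurable (commits_to i).
Proof.
rewrite (_ : commits_to i = \bigcap_(j in [set: 'I_n])
    [set s | alg_select (s, prefix_upto (fun=> 0) j) = (j \in key_set i)]).
  apply: fin_bigcap_measurable => // j _.
  have mf : measurable_fun [set: alg_seed A]
      (fun s => alg_select (s, prefix_upto (fun=> 0 : R) j)).
    exact: (measurable_fun_pair1 (prefix_upto (fun=> 0 : R) j)
        (@alg_select_measurable _ _ A j)).
  have := mf measurableT [set (j \in key_set i)].
  by rewrite setTI; apply.
apply/seteqP; split=> s /= selE.
  by move=> j _ /=; move/setP/(_ j): selE; rewrite inE.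
by apply/setP => j; rewrite inE; exact: selE.
Qed.

Lemma selected_key (s : alg_seed A) (x : 'I_n -> R) :
    (forall i, 0 <= x i) -> (forall i : 'I_n, (i < m)%N -> x i = 0) ->
  exists i : 'I_n, [/\ (m <= i)%N, selected s x = key_set i & commits_to i s].
Proof.
move=> x0 xm0.
have /imsetP[i mi xi] := A_feas s x0.
have /imsetP[i' mi' xi'] := A_feas s (fun _ : 'I_n => lexx (0 : R)).
rewrite !inE in mi mi'; exists i; split=> //.
rewrite /commits_to /= xi'; congr key_set; apply: key_set_inj => // j jm.
rewrite -xi -xi' !inE; congr (alg_select (s, _)).
(* The prefix up to a key [j] only has indices below [m], where [x] vanishes. *)
apply: eq_from_tnth => k; rewrite !tnth_mktuple xm0//=.
by apply: leq_ltn_trans jm; rewrite -ltnS.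
Qed.

(** Each seed commits to exactly one prize, so one term survives. Rectangles separate coins from
    seed, ready for the product measure. *)
Lemma alg_integrandE (z : coins n * alg_seed A) :
  \sum_(i in selected z.2 (fun j => prize_item j z.1)) prize_item i z.1 =
  \sum_(i < n | (m <= i)%N) \1_([set t : coins n | t i] `*` commits_to i) z.
Proof.
case: z => t s /=.
have [i||i [mi -> csi]] := @selected_key s (fun j => prize_item j t).
- exact: prize_item_ge0.
- by move=> i im; rewrite prize_itemE leqNgt im.
rewrite sum_key_set// (bigD1 i)//= big1 ?addr0.
  rewrite indicE; congr (nat_of_bool _)%:R; apply/idP/idP; rewrite inE//=.
  by case.
move=> j /andP[mj ji]; rewrite indicE memNset// => -[/= _].
rewrite /commits_to /= csi => keyE; move/negP: ji; apply; apply/eqP/esym.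
by apply: key_set_inj => // k _; rewrite keyE.
Qed.

(** The events are disjoint, as [key_set] is injective on prizes. *)
Lemma sum_commits_to :
  (\sum_(i < n | (m <= i)%N) alg_seed_prob A (commits_to i) <= 1)%E.
Proof.
pose Q := alg_seed_prob A.
have -> : (\sum_(i < n | (m <= i)%N) Q (commits_to i) =
    \int[Q]_s (\sum_(i <- [seq i : 'I_n <- index_enum _ | (m <= i)%N])
      (\1_(commits_to i) s)%:E))%E.
  rewrite ge0_integral_sum//=; last first.
    by move=> i; apply/measurable_EFinP/measurable_indic/measurable_commits_to.
  rewrite big_filter; apply: eq_bigr => i _.
  by rewrite integral_indic ?setIT//; exact: measurable_commits_to.
apply: (@le_trans _ _ (\int[Q]_s 1)%E); last first.
  by rewrite integral_cst// mul1e; exact: probability_le1.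
apply: ge0_le_integral => //.
- by move=> s _; rewrite sume_ge0// => i _; rewrite lee_fin.
- apply: emeasurable_sum => i.
  by apply/measurable_EFinP/measurable_indic/measurable_commits_to.
move=> s _; rewrite big_filter sumEFin lee_fin.
have [i||i [mi _ csi]] := @selected_key s (fun=> 0) => //.
rewrite (bigD1 i)//= big1 ?addr0 ?indicE ?mem_set//.
move=> j /andP[mj ji]; rewrite indicE memNset//.
rewrite /commits_to /= csi => keyE; move/negP: ji; apply; apply/eqP/esym.
by apply: key_set_inj => // k _; rewrite keyE.
Qed.

Lemma alg_value_key_le : (alg_value key_instance A <= p%:E)%E.
Proof.
pose Q := alg_seed_prob A.
rewrite /alg_value unlock /=.
under eq_integral do rewrite alg_integrandE -sumEFin -big_filter.
rewrite ge0_integral_sum//=; last first.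
  move=> i; apply/measurable_EFinP/measurable_indic.
  by apply: measurableX => //; exact: measurable_commits_to.
rewrite big_filter (eq_bigr (fun i => p%:E * Q (commits_to i)))%E => [|i _].
  rewrite -ge0_sume_distrr => [|//].
  rewrite -[leRHS]mule1 lee_wpmul2l ?lee_fin//; last exact: sum_commits_to.
  by case/andP: bias01.
rewrite integral_indic ?setIT//; last first.
  by apply: measurableX => //; exact: measurable_commits_to.
transitivity (P [set t : coins n | t i] * Q (commits_to i))%E.
  by apply: product_measure1E => //; exact: measurable_commits_to.
by rewrite -(coin_prob_true bias01 i).
Qed.

End algorithm.

Lemma competitive_ratio_key_ge (A : online_algorithm R n) :
  feasible key_family A ->
  ((1 / 4 * n%:R)%:E <= competitive_ratio key_instance A)%E.
Proof.
move=> A_feas.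
have alg_le := alg_value_key_le A_feas.
have p_lty : (p%:E < +oo)%E by exact: ltry.
have alg_ge0 : (0 <= alg_value key_instance A)%E.
  rewrite /alg_value expectation_ge0// => z; apply: sumr_ge0 => i _.
  exact: prize_item_ge0.
apply: lee_divr_of_mul_le.
- by apply: lt_le_trans prophet_key_ge; rewrite lte_fin.
- by rewrite alg_ge0 (le_lt_trans alg_le).
apply: le_trans prophet_key_ge.
apply: (@le_trans _ _ ((1 / 4 * n%:R)%:E * p%:E)%E).
  by rewrite lee_wpmul2l// lee_fin mulr_ge0.
rewrite -EFinM lee_fin /p ler_pdivrMr ?ltr0n ?subn_gt0 ?half_lt//.
(* Source of the constant [1 / 4]: the prophet's [1 / 2] over [p] is [(n - m) / 2], and [n - m] is
   at least [n / 2]. *)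
have : n%:R <= 2 * (n - m)%:R :> R by rewrite -natrM ler_nat /m; lia.
lra.
Qed.

End lower_bound.

Theorem theorem4p1 (R : realType) :
  (exists ALG : forall n : nat, {set {set 'I_n}} ->
       ('I_n -> probability R R) -> online_algorithm R n,
   exists C : R, (0 < C)%R /\
     forall (n : nat) (I : instance R n), (0 < n)%N ->
       let A := ALG n (feas I) (item_law I) in
       [/\ deterministic A, feasible (feas I) A &
           (competitive_ratio I A <= (C * n%:R)%:E)%E])
  /\
  (exists c : R, (0 < c)%R /\
     forall n : nat, (0 < n)%N ->
       exists I : instance R n, forall A : online_algorithm R n,
         feasible (feas I) A ->
         ((c * n%:R)%:E <= competitive_ratio I A)%E).
Proof.
split.
  exists (fun n F law => static_algorithm R (best_set F law)), 1; split=> //.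
  move=> n I _ /=; have [bestF _] := best_setP (item_law I) (feas_neq0 I).
  split=> [//|s x _|]; first by rewrite selected_static.
  rewrite /competitive_ratio alg_value_static mul1r.
  apply: lee_divl_of_le_mul => //.
  - by rewrite /prophet_value expectation_ge0// => w; exact: bigmax_ge_id.
  - exact: mean_sum_ge0.
  - exact: le_trans (prophet_le_cover I) (mean_sum_cover I).
exists (1 / 4); split=> [//|n n_gt0]; exists (key_instance R n_gt0) => A.
exact: competitive_ratio_key_ge.
Qed.
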